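(* For all integers $w$ and $k$ with $1\leq w\leq 3$ and $k\geq 1$, we have $f(k,w)=k^{w-1}$.
   Context: Vectors are elements of $\mathbb{Z}^w$; $A[i]$ denotes the $i$th coordinate of $A\in\mathbb{Z}^w$, $1\leq i\leq w$. For $A,B\in\mathbb{Z}^w$, $A\leq B$ means $A[i]\leq B[i]$ for every coordinate $i$ (product order); antichains in $\mathbb{Z}^w$ are with respect to this order. For an integer $k\geq 1$, vectors $A,B\in\mathbb{Z}^w$ are $k$-crossing if there are coordinates $i$ and $j$ with $A[i]-B[i]\geq k$ and $B[j]-A[j]\geq k$. (Thus a family is an antichain if and only if any two distinct members are $1$-crossing.) A family of vectors is $k$-crossing-free if it contains no two $k$-crossing vectors. For positive integers $k,w$, $f(k,w)$ denotes the maximum size of a $k$-crossing-free antichain in $\mathbb{Z}^w$. *)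

(* Defs.v *)
From HB Require Import structures.
From mathcomp Require Import all_boot all_order all_algebra.
From mathcomp Require Import boolp classical_sets functions cardinality.

Set Implicit Arguments.
Unset Strict Implicit.
Unset Printing Implicit Defensive.

Import Order.TTheory GRing.Theory Num.Theory.

Local Open Scope ring_scope.
Local Open Scope classical_set_scope.

(* Vectors of Z^w are integer row vectors; the coordinates 1, ..., w are
   indexed by 'I_w = {0, ..., w - 1}. *)
Definition vec_le (w : nat) (A B : 'rV[int]_w) : Prop :=
  forall i : 'I_w, A 0 i <= B 0 i.

Definition crossing (k w : nat) (A B : 'rV[int]_w) : Prop :=
  exists i j : 'I_w, k%:Z <= A 0 i - B 0 i /\ k%:Z <= B 0 j - A 0 j.

Definition antichain (w : nat) (F : set 'rV[int]_w) : Prop :=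
  forall A B : 'rV[int]_w, F A -> F B -> A <> B -> ~ vec_le A B.

Definition crossing_free (k w : nat) (F : set 'rV[int]_w) : Prop :=
  forall A B : 'rV[int]_w, F A -> F B -> A <> B -> ~ crossing k A B.

(* [is_f k w m] says that f(k, w) = m.  Families may be infinite, so that
   f(k, w) exists is part of the assertion; `I_m = {0, ..., m - 1}. *)
Definition is_f (k w m : nat) : Prop :=
  (exists F : set 'rV[int]_w,
      [/\ antichain F, crossing_free k F & (F #= `I_m)%card]) /\
  (forall F : set 'rV[int]_w,
      antichain F -> crossing_free k F -> (F #<= `I_m)%card).

(* Main.v *)
Require Import Defs.
From mathcomp Require Import all_boot all_order all_algebra.
From mathcomp Require Import boolp classical_sets functions cardinality.
(* [classical_sets] shadows [set0], [subsetP], [in_setT]: reopen [finset]. *)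
From mathcomp Require Import fintype finset zify.

(* Lower bound: the vectors (a_1, ..., a_(w-1), - sum a_i) with 0 <= a_i < k.

   Upper bound for w = 3.  Write a vector as (x, y, -h) and order a finite family
   V by A < B iff x and y are weakly larger at B.  Since V is an antichain, h is
   strictly increasing, and a staircase (x up, y down) is the same as an
   antichain of (V, <).  Let n <= k be the width of (V, <) and T = 2k - n >= k.
   Call a strictly increasing g : V -> nat close if g B - g A >= T forces
   x B - x A < k and y B - y A < k; h is close.  Let a(t) and b(t) be the widths
   of {g <= t} and {g >= t}.  Two facts finish the proof.
   - The level {g = t} has at most a(t) + b(t) - n elements.
   - Some close g satisfies a(t) + b(t + T) <= n for all t.  Indeed, if t violates
     this, then x + y grows by less than T from level t to level t + T,
     because staircases of sizes a(t) and b(t + T) below and above must fit in a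
     k by k square.  Hence no tight chain links the two levels, and g can
     be lowered by one on a set containing {g >= t + T}.
   Summing over t yields #|V| <= n * T = n (2k - n) <= k ^ 2. *)

Set Implicit Arguments.
Unset Strict Implicit.
Unset Printing Implicit Defensive.

Import Order.TTheory GRing.Theory Num.Theory.

Local Open Scope ring_scope.

(** * Staircases: one coordinate rises as the other falls *)

Section Staircases.
Variables (V : finType).
Implicit Types (x y : V -> int) (S : {set V}).

Definition staircase x y S :=
  forall A B, A \in S -> B \in S -> A != B ->
    x A < x B /\ y B < y A \/ x B < x A /\ y A < y B.

Lemma staircase_injl x y S : staircase x y S -> {in S &, injective x}.
Proof.
move=> sS A B AS BS eqx; apply/eqP/negPn/negP => neqAB.
by case: (sS A B AS BS neqAB); lia.
Qed.

Lemma staircase_sym x y S : staircase x y S -> staircase y x S.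
Proof. by move=> sS A B AS BS neqAB; case: (sS A B AS BS neqAB); lia. Qed.

Lemma staircase_opp x y S : staircase x y S -> staircase (-%R \o x) (-%R \o y) S.
Proof. by move=> sS A B AS BS neqAB /=; case: (sS A B AS BS neqAB); lia. Qed.

(** The members left of [E] have distinct integer values of [x], from the minimum, reached at [A],
    up to [x E - 1]. *)
Lemma staircase_left x y S E : staircase x y S -> E \in S ->
  exists2 A, A \in S & #|[set C in S | x C < x E]|%:Z <= x E - x A.
Proof.
move=> sS ES; pose A := [arg min_(A < E in S) x A]%O.
have [AS minA] : A \in S /\ forall B, B \in S -> x A <= x B.
  by rewrite /A; case: arg_minP => // i iS mi; split.
exists A => //.
pose n := `|x E - x A|%N; have leAE := minA E ES.
have : (#|[set C in S | (x C < x E)%R]| <= n)%N; last by rewrite /n; lia.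
pose f (C : V) := `|x C - x A|%N.
rewrite cardE -(size_map f) -[leqRHS](size_iota 0); apply: uniq_leq_size.
  rewrite map_inj_in_uniq ?enum_uniq // => C D.
  rewrite !mem_enum !inE => /andP[CS _] /andP[DS _] eqf.
  apply: (staircase_injl sS) => //.
  by have := minA C CS; have := minA D DS; rewrite /f in eqf; lia.
move=> _ /mapP[C + ->]; rewrite mem_enum inE mem_iota => /andP[CS ltCE].
by have := minA C CS; rewrite /f /n; lia.
Qed.

(** Every member other than [E] has a smaller [x] or a smaller [y], so two uses of [staircase_left]
    count them all. *)
Lemma staircase_lower x y S E : staircase x y S -> E \in S ->
  exists A B, [/\ A \in S, B \in S & x A + y B + #|S|%:Z <= x E + y E + 1].
Proof.
move=> sS ES; have [A AS leA] := staircase_left sS ES.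
have [B BS leB] := staircase_left (staircase_sym sS) ES.
exists A, B; split=> //.
have : (#|S| <= 1 + (#|[set C in S | (x C < x E)%R]| + #|[set C in S | (y C < y E)%R]|))%N.
  rewrite (cardsD1 E) ES leq_add2l -cardsUI.
  apply: leq_trans (leq_addr _ _); apply: subset_leq_card; apply/subsetP => C.
  rewrite !inE => /andP[neqCE CS]; rewrite CS /=.
  by case: (sS C E CS ES neqCE) => [[-> _]|[_ ->]]; rewrite ?orbT.
by lia.
Qed.

Lemma staircase_upper x y S E : staircase x y S -> E \in S ->
  exists A B, [/\ A \in S, B \in S & x E + y E + #|S|%:Z <= x A + y B + 1].
Proof.
move=> /staircase_opp sS ES; have [A [B [AS BS /=]]] := staircase_lower sS ES.
by exists A, B; split=> //; lia.
Qed.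

Lemma staircase_card x y S (k : nat) : staircase x y S ->
  (forall A B, A \in S -> B \in S ->
     ~ (k%:Z <= x B - x A /\ k%:Z <= y A - y B)) -> (0 < k)%N ->
  (#|S| <= k)%N.
Proof.
move=> sS free k_gt0; case: (set_0Vmem S) => [->|[E0 E0S]]; first by rewrite cards0.
pose E := [arg min_(A < E0 in S) x A]%O.
have [ES minE] : E \in S /\ forall B, B \in S -> x E <= x B.
  by rewrite /E; case: arg_minP => // i iS mi; split.
pose D := [arg min_(A < E0 in S) y A]%O.
have [DS minD] : D \in S /\ forall B, B \in S -> y D <= y B.
  by rewrite /D; case: arg_minP => // i iS mi; split.
(* From the leftmost [E] to the lowest [D], [x] rises and [y] falls by at least [#|S| - 1]. *)
have [A [B [AS BS]]] := staircase_lower sS ES.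
have [A' [B' [AS' BS']]] := staircase_lower sS DS.
have := free E D ES DS.
have := minE A AS; have := minE A' AS'; have := minD B BS; have := minD B' BS'.
by lia.
Qed.

End Staircases.

(** * Antichains of the order [below], and widths *)

Section Width.
Variables (V : finType) (x y : V -> int).
Implicit Types (S D : {set V}) (g : V -> nat).

(** Distinct elements with equal [x] and [y] are below each other; the existence of an [increasing]
    function excludes this. *)
Definition below A B := [&& A != B, x A <= x B & y A <= y B].

Definition unrelated S := [forall A in S, forall B in S, ~~ below A B].

Lemma unrelatedP S : reflect (staircase x y S) (unrelated S).
Proof.
apply: (iffP forall_inP) => [unS A B AS BS neqAB | sS A AS].
  have /forall_inP/(_ _ BS) := unS A AS; have /forall_inP/(_ _ AS) := unS B BS.
  by rewrite /below eq_sym neqAB /=; lia.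
apply/forall_inP => B BS; apply/negP => /and3P[neqAB].
by case: (sS A B AS BS neqAB); lia.
Qed.

Definition width D := \max_(S : {set V} | (S \subset D) && unrelated S) #|S|.

Lemma leq_width S D : S \subset D -> unrelated S -> (#|S| <= width D)%N.
Proof. by move=> sSD unS; rewrite /width (bigD1 S) ?sSD //= leq_maxl. Qed.

Lemma width_witness D : exists S, [/\ S \subset D, unrelated S & #|S| = width D].
Proof.
have : (0 < #|[pred S : {set V} | (S \subset D) && unrelated S]|)%N.
  apply/card_gt0P; exists set0; rewrite inE sub0set /=.
  by apply/unrelatedP => A B; rewrite inE.
move=> /(eq_bigmax_cond (fun S : {set V} => #|S|))[S /andP[sSD unS] eqS].
by exists S; split=> //; rewrite -eqS.
Qed.

Lemma width_sub D D' : D \subset D' -> (width D <= width D')%N.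
Proof.
move=> sD; have [S [sSD unS <-]] := width_witness D.
by apply: leq_width => //; apply: subset_trans sD.
Qed.

Lemma width_comparable S D C : S \subset D -> unrelated S -> #|S| = width D ->
  C \in D -> exists2 E, E \in S & [|| E == C, below E C | below C E].
Proof.
move=> sSD unS cardS CD; apply/exists_inP; apply: contraT.
rewrite negb_exists_in => /forall_inP noE.
have CnS : C \notin S by apply/negP => /noE; rewrite eqxx.
suff: (#|C |: S| <= width D)%N by rewrite cardsU1 CnS cardS ltnn.
apply: leq_width; first by rewrite subUset sub1set CD.
have bC : ~~ below C C by rewrite /below eqxx.
move/forall_inP: unS => unS.
apply/forall_inP => A; rewrite !inE => /orP[/eqP->|AS]; apply/forall_inP => B;
  rewrite !inE => /orP[/eqP->|BS] //.
- by have := noE B BS; rewrite !negb_or => /and3P[].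
- by have := noE A AS; rewrite !negb_or => /and3P[].
- by move/forall_inP: (unS A AS); apply.
Qed.

Definition increasing g := forall A B, below A B -> (g A < g B)%N.

(** Cut a maximum antichain [S] at height [t]. Its low part with [R :\: R1] and its high part with
    [R :\: R2] are antichains. These two subsets of the level [R] cover it and both contain
    [S :&: R], so the sizes add up to at least [#|R| + #|S|]. *)
Lemma card_level g t : increasing g ->
  (#|[set A | g A == t]| + width [set: V] <=
     width [set A | (g A <= t)%N] + width [set A | (t <= g A)%N])%N.
Proof.
move=> g_inc; set R := [set A | g A == t].
have [S [_ unS <-]] := width_witness [set: V].
pose R1 := [set r in R | [exists s in S, (g s < t)%N && below s r]].
pose R2 := [set r in R | [exists s in S, (t < g s)%N && below r s]].
pose Sl := [set s in S | (g s < t)%N]; pose Sh := [set s in S | (t < g s)%N].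
have unSP A B : A \in S -> B \in S -> ~~ below A B.
  by move=> AS BS; move/forall_inP: unS => /(_ A AS)/forall_inP; apply.
have lt_below A B : (g B <= g A)%N -> ~~ below A B.
  by rewrite leqNgt; apply: contra => /g_inc.
have lo : (#|Sl :|: (R :\: R1)| <= width [set A | (g A <= t)%N])%N.
  apply: leq_width.
    by apply/subsetP => A; rewrite !inE => /orP[/andP[_ /ltnW]|/andP[_ /eqP->]].
  apply/forall_inP => A; rewrite !inE => /orP[/andP[AS ltA]|/andP[nA /eqP gA]];
    apply/forall_inP => B; rewrite !inE => /orP[/andP[BS ltB]|/andP[nB /eqP gB]].
  - exact: unSP.
  - move: nB; rewrite gB eqxx /= negb_exists_in => /forall_inP/(_ A AS).
    by rewrite ltA.
  - by apply: lt_below; lia.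
  - by apply: lt_below; lia.
have hi : (#|Sh :|: (R :\: R2)| <= width [set A | (t <= g A)%N])%N.
  apply: leq_width.
    by apply/subsetP => A; rewrite !inE => /orP[/andP[_ /ltnW]|/andP[_ /eqP->]].
  apply/forall_inP => A; rewrite !inE => /orP[/andP[AS ltA]|/andP[nA /eqP gA]];
    apply/forall_inP => B; rewrite !inE => /orP[/andP[BS ltB]|/andP[nB /eqP gB]].
  - exact: unSP.
  - by apply: lt_below; lia.
  - move: nA; rewrite gA eqxx /= negb_exists_in => /forall_inP/(_ B BS).
    by rewrite ltB.
  - by apply: lt_below; lia.
apply: leq_trans (leq_add lo hi).
have disjl : [disjoint Sl & R :\: R1].
  by rewrite -setI_eq0; apply/eqP/setP => A; rewrite !inE; apply/negP; lia.
have disjh : [disjoint Sh & R :\: R2].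
  by rewrite -setI_eq0; apply/eqP/setP => A; rewrite !inE; apply/negP; lia.
rewrite !cardsU (disjoint_setI0 disjl) (disjoint_setI0 disjh) cards0 !subn0.
have below_trans A B C : below A B -> below B C -> below A C.
  move=> AB BC; have := g_inc _ _ AB; have := g_inc _ _ BC.
  move: AB BC; rewrite /below => /and3P[_ ? ?] /and3P[_ ? ?] ? ?.
  apply/and3P; split; [|lia|lia].
  by apply: contraTneq isT => eqAC; subst; lia.
(* An element of both R1 and R2 would lie between two elements of S. *)
have RU : (R :\: R1) :|: (R :\: R2) = R.
  apply/setP => A; rewrite !in_setU !in_setD; case AR: (A \in R); rewrite ?andbF // !andbT.
  rewrite -negb_and; apply/negP => /andP[].
  rewrite [A \in R1]in_set [A \in R2]in_set AR /=.
  move=> /exists_inP[s sS /andP[_ sA]] /exists_inP[s' s'S /andP[_ As']].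
  by have := unSP s s' sS s'S; rewrite (below_trans _ _ _ sA As').
have SRI : S :&: R \subset (R :\: R1) :&: (R :\: R2).
  apply/subsetP => A; rewrite in_setI => /andP[AS AR].
  rewrite in_setI !in_setD AR !andbT [A \in R1]in_set [A \in R2]in_set AR /=.
  apply/andP; split; apply/negP => /exists_inP[s sS /andP[_]]; exact/negP/unSP.
have SE : S = Sl :|: (S :&: R) :|: Sh.
  apply/setP => A; rewrite !inE; case: (A \in S) => //=.
  by case: ltngtP.
have cS : (#|S| <= #|Sl| + #|S :&: R| + #|Sh|)%N.
  rewrite {1}SE; apply: leq_trans (leq_card_setU _ _) _.
  by rewrite leq_add2r leq_card_setU.
have := subset_leq_card SRI; have := cardsUI (R :\: R1) (R :\: R2); rewrite RU.
by move: cS; lia.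
Qed.

End Width.

(** * Lowering heights until no level is saturated *)

Section Heights.
Variables (V : finType) (x y : V -> int) (k T : nat).
Implicit Types (A B C D : V) (g : V -> nat).

Let n := width x y [set: V].

Definition saturated g t :=
  (n < width x y [set A | (g A <= t)%N] + width x y [set A | (t + T <= g A)%N])%N.

Lemma card_unsaturated g : increasing x y g -> (forall t, ~~ saturated g t) ->
  (#|V| <= n * T)%N.
Proof.
move=> g_inc unsat.
pose m := (\max_A g A).+1; pose N := (T + m)%N.
pose a t := width x y [set A | (g A <= t)%N].
pose b t := width x y [set A | (t <= g A)%N].
have a_le t : (a t <= n)%N by apply: width_sub; apply: subsetT.
have b_le t : (b t <= n)%N by apply: width_sub; apply: subsetT.
have sum_level : #|V| = (\sum_(t < N) #|[set A | g A == t :> nat]|)%N.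
  rewrite -sum1_card (partition_big (fun A => inord (g A) : 'I_(T + m.-1).+1) xpredT) //=.
  rewrite /N addnS; apply: eq_bigr => t _; rewrite sum1dep_card; apply: eq_card => A.
  rewrite !inE -val_eqE /= inordK //.
  have : (g A < m)%N by rewrite ltnS; apply: leq_bigmax.
  by rewrite /m /=; lia.
have level_le : (\sum_(t < N) (#|[set A | g A == t :> nat]| + n) <= \sum_(t < N) (a t + b t))%N.
  by apply: leq_sum => t _; apply: card_level.
apply: (@leq_trans (\sum_(t < N) #|[set A | g A == t :> nat]|)%N); first by rewrite -sum_level.
move: level_le; rewrite !big_split /= sum_nat_const card_ord.
(* The last [T] values of [a] and the first [T] of [b] are at most [n]; the remaining ones pair up
   as [a t] and [b (t + T)]. *)
suff [sa sb] : (\sum_(t < N) a t <= \sum_(t < m) a t + T * n)%N /\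
    (\sum_(t < N) b t + \sum_(t < m) a t <= T * n + m * n)%N.
  rewrite {1}/N mulnDl (mulnC n); move: sa sb.
  move: (\sum_(t < N) #|_|)%N (\sum_(t < N) a t)%N (\sum_(t < N) b t)%N => v sa sb.
  move: (\sum_(t < m) a t)%N => sm.
  by move: (T * n)%N (m * n)%N => Tn mn; lia.
have sumn r : (r * n = \sum_(t < r) n)%N by rewrite sum_nat_const card_ord.
split.
  rewrite /N addnC big_split_ord /= leq_add2l sumn.
  by apply: leq_sum => t _; apply: a_le.
rewrite /N big_split_ord /= -addnA -big_split /= !sumn.
apply: leq_add; apply: leq_sum => t _; first exact: b_le.
by have := unsat t; rewrite /saturated -leqNgt addnC [(T + t)%N]addnC.
Qed.

Definition close g := forall A B, (g A + T <= g B)%N ->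
  x B - x A < k%:Z /\ y B - y A < k%:Z.

(** Maximum antichains on the two sides contain some [E] weakly below [A] and [F] weakly above [D].
    The staircase bounds at [E] and [F] produce members to which [close] applies; its two strict
    inequalities absorb both [+ 1]. *)
Lemma width_gap g t A D : increasing x y g -> close g ->
    g A = t -> g D = (t + T)%N ->
  x D + y D + (width x y [set A | (g A <= t)%N])%:Z
    + (width x y [set A | (t + T <= g A)%N])%:Z <= x A + y A + k%:Z + k%:Z.
Proof.
move=> g_inc g_close gA gD.
have [S [sSA unS cardS]] := width_witness x y [set A | (g A <= t)%N].
have [R [sRA unR cardR]] := width_witness x y [set A | (t + T <= g A)%N].
have [|E ES EA] := width_comparable (C := A) sSA unS cardS; first by rewrite inE gA.
have [|F FR FD] := width_comparable (C := D) sRA unR cardR; first by rewrite inE gD.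
move/subsetP: sSA => sS; move/subsetP: sRA => sR.
have {EA} leEA : x E <= x A /\ y E <= y A.
  case/or3P: EA => [/eqP->|/and3P[_ ? ?]|/g_inc] //.
  by have := sS E ES; rewrite inE gA; lia.
have {FD} leDF : x D <= x F /\ y D <= y F.
  case/or3P: FD => [/eqP->|/g_inc|/and3P[_ ? ?]] //.
  by have := sR F FR; rewrite inE gD; lia.
have [A1 [A2 [A1S A2S]]] := staircase_lower (unrelatedP _ _ _ unS) ES.
have [B1 [B2 [B1R B2R]]] := staircase_upper (unrelatedP _ _ _ unR) FR.
have [|c1 _] := g_close A1 B1.
  by have := sS A1 A1S; have := sR B1 B1R; rewrite !inE; lia.
have [|_ c2] := g_close A2 B2.
  by have := sS A2 A2S; have := sR B2 B2R; rewrite !inE; lia.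
by rewrite cardS cardR; lia.
Qed.

Hypotheses (T_gt0 : (0 < T)%N) (nT : (n + T = k + k)%N).

Lemma lower_heights g t : increasing x y g -> close g -> saturated g t ->
  exists g', [/\ increasing x y g', close g' & (\sum_A g' A < \sum_A g A)%N].
Proof.
move=> g_inc g_close sat.
(* Besides {g >= t + T}, [W] contains whatever could be linked to level t + T by a
   chain along which g grows by unit steps: x + y must grow at least as fast. *)
pose W C := (t < g C)%N && ((t + T <= g C)%N || [exists D, [&& g D == (t + T)%N,
  x C <= x D, y C <= y D & (t + T)%:Z - (g C)%:Z <= x D + y D - (x C + y C)]]).
(* An obstruction at level t would be an element of level t lying below an element
   of level t + T with x + y larger by at least T, against [width_gap]. *)
have W_down A B : below x y A B -> W B -> g B = (g A).+1 -> W A.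
  move=> AB; have := AB => /and3P[neqAB xAB yAB] /andP[tB WB] gB.
  (* Equal sums would put [B] below [A] too; so [x + y] grows by at least one, like [g]. *)
  have neqxy : x A + y A < x B + y B.
    have : ~~ below x y B A by apply/negP => /g_inc; lia.
    by rewrite /below eq_sym neqAB /=; lia.
  have [gA|ltgA] := leqP (t + T) (g A); first by rewrite /W gA; lia.
  have /exists_inP[D /eqP gD /and3P[xD yD tD]] : [exists (D | g D == (t + T)%N),
      [&& x A <= x D, y A <= y D & (t + T)%:Z - (g A)%:Z <= x D + y D - (x A + y A)]].
    case/orP: WB => [tTB|/existsP[D /and4P[gD xD yD tD]]]; apply/exists_inP.
      by exists B; [apply/eqP; lia | apply/and3P; split; lia].
    by exists D => //; apply/and3P; split; lia.
  have [tA|leAt] := ltnP t (g A).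
    rewrite /W tA /=; apply/orP; right; apply/existsP; exists D.
    by rewrite gD eqxx xD yD tD.
  have gA : g A = t by lia.
  have := width_gap g_inc g_close gA gD.
  by move: sat; rewrite /saturated; lia.
have W_gt0 A : W A -> (0 < g A)%N by case/andP; lia.
have [D DW] : exists D, W D.
  have [R [/subsetP sR _ cardR]] := width_witness x y [set A | (t + T <= g A)%N].
  have : (0 < #|R|)%N.
    have := width_sub x y (subsetT [set A | (g A <= t)%N]).
    by move: sat; rewrite /saturated -cardR -/n; lia.
  case/card_gt0P => D /sR; rewrite inE => gD; exists D.
  by rewrite /W gD; lia.
exists (fun A => g A - W A)%N; split.
(* Only a unit step of [g] with [B] alone lowered could break monotonicity; [W_down] forbids it. *)
- move=> A B AB; have := g_inc _ _ AB; have := W_down A B AB.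
  have := W_gt0 A; have := W_gt0 B.
  by case: (W B); case: (W A) => //=; lia.
(* If [A] is lowered and the new gap is at least [T], then [g B >= t + T], so [B] is lowered too. *)
- move=> A B; have := W_gt0 A; case WA: (W A) => /=; last first.
    by move=> _ gAB; apply: g_close; lia.
  move=> /(_ isT) gA0; case WB: (W B) => /= gAB; apply: g_close; first lia.
  have : ~~ (t + T <= g B)%N.
    by apply: contraFN WB => tB; rewrite /W tB; lia.
  by case/andP: WA => tA _; lia.
- rewrite (bigD1 D) //= [X in (_ < X)%N](bigD1 D) //= DW.
  have := W_gt0 D DW; have : (\sum_(A | A != D) (g A - W A) <= \sum_(A | A != D) g A)%N.
    by apply: leq_sum => A _; apply: leq_subr.
  by lia.
Qed.

(** Repeated lowering stops because the sum of the heights drops each time. *)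
Lemma unsaturated_heights g : increasing x y g -> close g ->
  exists g', [/\ increasing x y g', close g' & forall t, ~~ saturated g' t].
Proof.
have [m] := ubnP (\sum_A g A)%N; elim: m g => // m IHm g lem g_inc g_close.
have [[t sat]|unsat] := pselect (exists t, saturated g t).
  have [g' [g'_inc g'_close lt_g']] := lower_heights g_inc g_close sat.
  by apply: (IHm g') => //; lia.
by exists g; split=> // t; apply/negP => sat; apply: unsat; exists t.
Qed.

End Heights.

Lemma card_le_square (V : finType) (x y h : V -> int) (k : nat) :
    (0 < k)%N ->
    (forall A B, below x y A B -> h A < h B) ->
    (forall A B, k%:Z <= x B - x A \/ k%:Z <= y B - y A -> h B - h A < k%:Z) ->
    (forall A B, ~ (k%:Z <= x B - x A /\ k%:Z <= y A - y B)) ->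
  (#|V| <= k ^ 2)%N.
Proof.
move=> k_gt0 h_inc h_close xy_free.
have n_le : (width x y [set: V] <= k)%N.
  have [S [_ /unrelatedP sS <-]] := width_witness x y [set: V].
  by apply: staircase_card sS _ k_gt0 => A B _ _; apply: xy_free.
pose T := (k + k - width x y [set: V])%N.
(* The shift makes all heights nonnegative and keeps their differences. *)
pose g A := `|(h A + \sum_B `|h B|)%R|%N.
have gE A : (g A)%:Z = h A + \sum_B `|h B|.
  rewrite /g gez0_abs // (bigD1 A) //=.
  by rewrite addrA addr_ge0 ?sumr_ge0 //; lia.
have g_inc : increasing x y g.
  by move=> A B /h_inc; have := gE A; have := gE B; lia.
have g_close : close x y k T g.
  move=> A B gAB; have := h_close A B; have := gE A; have := gE B.
  by move: gAB; rewrite /T; lia.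
have [||g' [g'_inc _ unsat]] := unsaturated_heights _ _ g_inc g_close.
- by rewrite /T; lia.
- by rewrite /T; lia.
apply: leq_trans (card_unsaturated g'_inc unsat) _.
by rewrite /T; move: n_le; move: (width _ _ _) => n n_le; nia.
Qed.

(** * Passage from sets to finite families, and the two bounds *)

Lemma card_le_II_injective (T : Type) (F : set T) (m : nat) :
    (forall f : 'I_m.+1 -> T, injective f -> (forall i, F (f i)) -> False) ->
  (F #<= `I_m)%card.
Proof.
move=> noinj; apply: contrapT => notle.
(* An infinite [F], or a finite one with more than [m] elements, contains a copy of [I_m.+1]. *)
suff /card_leP[f] : (`I_m.+1 #<= F)%card.
  pose g (i : 'I_m.+1) := f (SigSub (mem_set (ltn_ord i : `I_m.+1 i))).
  apply: (noinj (fun i => val (g i))) => [i j /val_inj eqg | i].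
    apply: val_inj; have inT := classical_sets.in_setT.
    by have /(congr1 val) := 'inj_f (inT _ _) (inT _ _) eqg.
  exact: set_valP.
have [/finite_setP[n Fn]|/infiniteP] := pselect (finite_set F).
  rewrite (card_le_eqr Fn) card_le_II ltnNge.
  by apply/negP => nm; apply: notle; rewrite (card_le_eql Fn) card_le_II.
by apply: card_le_trans; apply: subset_card_le.
Qed.

(** The coordinates of each vector sum to zero, so comparable vectors coincide. A difference of [k]
    fits only in the last coordinate, which cannot supply both signs. *)
Lemma crossing_free_antichain_box (m k : nat) : (0 < k)%N ->
  exists F : set 'rV[int]_m.+1,
    [/\ antichain F, crossing_free k F & (F #= `I_(k ^ m))%card].
Proof.
move=> k_gt0; pose N := #|{ffun 'I_m -> 'I_k}|.
pose c (f : {ffun 'I_m -> 'I_k}) j : int := (f j)%:Z.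
pose phi f : 'rV[int]_m.+1 :=
  \row_i if unlift ord_max i is Some j then c f j else - \sum_j c f j.
have phi_lift f j : phi f 0 (lift ord_max j) = c f j by rewrite mxE liftK.
have phi_max f : phi f 0 ord_max = - \sum_j c f j by rewrite mxE unlift_none.
have phi_inj : injective phi.
  move=> f g eqfg; apply/ffunP => j; apply: val_inj.
  by have := congr1 (fun A : 'rV_m.+1 => A 0 (lift ord_max j)) eqfg; rewrite !phi_lift => -[].
have c_lt f g j : ~ k%:Z <= c f j - c g j.
  by rewrite /c; have := ltn_ord (f j); lia.
exists (range (phi \o (enum_val : 'I_N -> _))); split.
- move=> _ _ [i _ <-] [j _ <-] /= neq le_ij; apply: neq; congr phi.
  move: (enum_val i) (enum_val j) le_ij => f g le_fg.
  have le_c l : c f l <= c g l by rewrite -!phi_lift.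
  have sum0 : \sum_l (c g l - c f l) = 0.
    apply/eqP; rewrite sumrB subr_eq0 eq_le; apply/andP; split; last exact: ler_sum.
    by have := le_fg ord_max; rewrite !phi_max lerN2.
  apply/ffunP => l; suff [/val_inj] : c f l = c g l by [].
  apply/esym/eqP; rewrite -subr_eq0; apply/eqP.
  by move: l (isT : true); apply: psumr_eq0P sum0 => l _; rewrite subr_ge0.
- move=> _ _ [i _ <-] [j _ <-] _ /=; move: (enum_val i) (enum_val j) => f g [a [b []]].
  case: (unliftP ord_max a) => [a' ->|->]; first by rewrite !phi_lift => /c_lt.
  case: (unliftP ord_max b) => [b' ->|->]; first by rewrite !phi_lift => _ /c_lt.
  by lia.
- rewrite (card_eql (inj_card_eq _)); last first.
    by apply: in2W; apply: inj_comp phi_inj enum_val_inj.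
  have <- : N = (k ^ m)%N by rewrite /N card_ffun !card_ord.
  by rewrite card_eq_sym; apply: card_II.
Qed.

Lemma crossing_free_antichain_le (m k : nat) (F : set 'rV[int]_m.+1) :
    (m < 3)%N -> (0 < k)%N -> antichain F -> crossing_free k F ->
  (F #<= `I_(k ^ m))%card.
Proof.
move=> m3 k_gt0 anti free; have [N NE] : exists N, N = (k ^ m)%N by exists (k ^ m)%N.
rewrite -NE; apply: card_le_II_injective => f f_inj fF.
have not_le A B : A != B -> ~ vec_le (f A) (f B).
  by move=> /eqP neqAB; apply: anti => // /f_inj.
have not_cross A B i j : k%:Z <= f A 0 i - f B 0 i -> ~ k%:Z <= f B 0 j - f A 0 j.
  move=> ki kj; apply: (free (f A) (f B)) => //; last by exists i, j.
  by move=> eqAB; move: ki; rewrite eqAB; lia.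
suff : (#|'I_N.+1| <= N)%N by rewrite card_ord ltnn.
rewrite [leqRHS]NE; clear F fF anti free NE.
case: m m3 f f_inj not_le not_cross => [|[|[|//]]] _ f _ not_le not_cross.
(* Integers are totally ordered, so distinct members cannot exist; the single coordinate serves as
   both [x] and [y], with bound [k ^ 0]. *)
- rewrite -cardsT; apply: (@staircase_card _ (fun A => f A 0 0) (fun A => f A 0 0)) => //.
    move=> A B _ _ neqAB; have notAB := not_le A B neqAB.
    have := not_le B A; rewrite eq_sym neqAB => /(_ isT) notBA.
    case: (lerP (f A 0 0) (f B 0 0)) => [leAB|/ltW leBA].
      by case: notAB => i; rewrite (ord1 i).
    by case: notBA => i; rewrite (ord1 i).
  by move=> A B _ _; lia.
- rewrite -cardsT expn1; pose x i := f i 0 ord0; pose y i := f i 0 ord_max.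
  have ord2 (i : 'I_2) : i = ord0 \/ i = ord_max.
    by case: i => [[|[|//]]] lti; [left|right]; apply: val_inj.
  have le_f A B : A != B -> ~~ ((x A <= x B) && (y A <= y B)).
    move=> /not_le notAB; apply/negP => /andP[lex ley]; apply: notAB => i.
    by case: (ord2 i) => ->.
  apply: (@staircase_card _ x y) => // [A B _ _ neqAB | A B _ _ [kx ky]].
    by have := le_f A B neqAB; have := le_f B A; rewrite eq_sym neqAB; lia.
  exact: (not_cross B A ord0 ord_max).
- pose x i := f i 0 (inord 0); pose y i := f i 0 (inord 1); pose h i := - f i 0 (inord 2).
  have ord3 (i : 'I_3) : [\/ i = inord 0, i = inord 1 | i = inord 2].
    by case: i => [[|[|[|//]]]] lti; [apply: Or31|apply: Or32|apply: Or33];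
      apply: val_inj; rewrite /= inordK.
  apply: (@card_le_square _ x y h) => // [A B /and3P[neqAB lex ley]|A B|A B [kx ky]].
  - rewrite ltNge; apply/negP => leh; apply: (not_le A B neqAB) => i.
    by case: (ord3 i) => ->; rewrite // -lerN2.
  - move=> kxy; rewrite ltNge; apply/negP => kh.
    have {}kh : k%:Z <= f A 0 (inord 2) - f B 0 (inord 2) by rewrite /h in kh; lia.
    by case: kxy => kxy; apply: not_cross kxy kh.
  - exact: (not_cross B A (inord 0) (inord 1)).
Qed.

Theorem theorem2 (w k : nat) (hw1 : (1 <= w)%N) (hw3 : (w <= 3)%N)
  (hk : (1 <= k)%N) : is_f k w (k ^ (w - 1))%N.
Proof.
case: w hw1 hw3 => // m _ hm; rewrite subn1; split.
  exact: crossing_free_antichain_box.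
by move=> F; apply: crossing_free_antichain_le.
Qed.
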